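(* Let $\mathscr Q_n$ be a non-singular quadric in $\mathrm{PG}(n,2)$ of projective index $g\geq1$, let $\Gamma$ be its point-graph, and for $0\le s<g$ let $\Gamma_s$ be the graph constructed from an $s$-dimensional subspace $\alpha_s$ contained in $\mathscr Q_n$ as described below. Then $\Gamma_s$ is isomorphic to $\Gamma$ if and only if $s=0$.
   Context: A non-singular quadric $\mathscr Q_n$ in $\mathrm{PG}(n,2)$ is the point set of a non-degenerate quadric; its projective index $g$ is the largest dimension of a projective subspace contained in $\mathscr Q_n$. The point-graph $\Gamma$ has vertex set the points of $\mathscr Q_n$, two distinct points adjacent iff the line joining them is contained in $\mathscr Q_n$. For $0\le s<g$ and an $s$-dimensional subspace $\alpha_s\subseteq\mathscr Q_n$: a point $X$ of $\mathscr Q_n$ has type (i) if $X\in\alpha_s$; type (ii) if $X\notin\alpha_s$ and $\langle\alpha_s,X\rangle\subseteq\mathscr Q_n$; type (iii) otherwise. Let $\mathcal X_s$ be the type (ii) points and $\mathcal Y_s$ the points of type (i) or (iii). The graph $\Gamma_s$ has the same vertex set as $\Gamma$ and the same edges, except that for each vertex $R\in\mathcal Y_s$ having exactly $\frac12|\mathcal X_s|$ neighbours in $\mathcal X_s$ (in $\Gamma$), those edges are deleted and $R$ is joined instead to the other $\frac12|\mathcal X_s|$ vertices of $\mathcal X_s$. *)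

(* Defs.v *)
From HB Require Import structures.
From mathcomp Require Import all_boot all_order all_algebra.
Set Implicit Arguments. Unset Strict Implicit. Unset Printing Implicit Defensive.
Import GRing.Theory.
Local Open Scope ring_scope.

(* Vectors of F_2^(n+1); the points of PG(n,2) are exactly the nonzero vectors
   (each projective point has a unique nonzero representative over F_2). *)
Notation vec n := 'rV['F_2]_(n.+1).

(* A quadratic form on F_2^(n+1), given by a matrix A: Q(x) = x A x^T.
   Every quadratic form over F_2 is of this shape. *)
Definition qf (n : nat) (A : 'M['F_2]_(n.+1)) (x : vec n) : 'F_2 :=
  (x *m A *m x^T) 0 0.

Definition polar (n : nat) (A : 'M['F_2]_(n.+1)) (x y : vec n) : 'F_2 :=
  qf A (x + y) - qf A x - qf A y.

Definition nonsingular (n : nat) (A : 'M['F_2]_(n.+1)) : Prop :=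
  forall x : vec n, x != 0 -> qf A x = 0 -> ~ (forall y, polar A x y = 0).

(* A (projective) subspace, given by its underlying vector subspace U,
   is contained in the quadric. *)
Definition totally_singular (n : nat) (A : 'M['F_2]_(n.+1))
    (U : {vspace vec n}) : bool :=
  [forall v : vec n, (v \in U) ==> (qf A v == 0)].

(* g is the projective index: the largest projective dimension of a subspace
   contained in the quadric (projective dim = vector dim - 1). *)
Definition proj_index (n : nat) (A : 'M['F_2]_(n.+1)) (g : nat) : Prop :=
  (exists U : {vspace vec n}, totally_singular A U /\ \dim U = g.+1) /\
  (forall U : {vspace vec n}, totally_singular A U -> (\dim U <= g.+1)%N).

Definition qpoints (n : nat) (A : 'M['F_2]_(n.+1)) : {set vec n} :=
  [set v | (v != 0) && (qf A v == 0)].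

Definition gadj (n : nat) (A : 'M['F_2]_(n.+1)) (x y : vec n) : bool :=
  (x != y) && totally_singular A (<[x]> + <[y]>)%VS.

Definition type_i (n : nat) (A : 'M['F_2]_(n.+1)) (U : {vspace vec n}) (X : vec n) : bool :=
  (X \in qpoints A) && (X \in U).
Definition type_ii (n : nat) (A : 'M['F_2]_(n.+1)) (U : {vspace vec n}) (X : vec n) : bool :=
  [&& X \in qpoints A, X \notin U & totally_singular A (U + <[X]>)%VS].
Definition type_iii (n : nat) (A : 'M['F_2]_(n.+1)) (U : {vspace vec n}) (X : vec n) : bool :=
  [&& X \in qpoints A, ~~ type_i A U X & ~~ type_ii A U X].

Definition Xs (n : nat) (A : 'M['F_2]_(n.+1)) (U : {vspace vec n}) : {set vec n} :=
  [set X | type_ii A U X].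
Definition Ys (n : nat) (A : 'M['F_2]_(n.+1)) (U : {vspace vec n}) : {set vec n} :=
  [set X | type_i A U X || type_iii A U X].

Definition switching (n : nat) (A : 'M['F_2]_(n.+1)) (U : {vspace vec n}) (R : vec n) : bool :=
  (R \in Ys A U) && ((#|[set P in Xs A U | gadj A R P]|).*2 == #|Xs A U|)%N.

Definition gadj_s (n : nat) (A : 'M['F_2]_(n.+1)) (U : {vspace vec n}) (x y : vec n) : bool :=
  if switching A U x && (y \in Xs A U) then ~~ gadj A x y
  else if switching A U y && (x \in Xs A U) then ~~ gadj A x y
  else gadj A x y.

Definition graph_iso (T : finType) (V : {set T}) (e1 e2 : rel T) : Prop :=
  exists f : T -> T,
    [/\ {in V &, injective f}, f @: V = V &
        {in V &, forall x y, e2 (f x) (f y) = e1 x y}].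

(* Main.v *)
Require Import Defs.
From HB Require Import structures.
From mathcomp Require Import all_boot all_order all_algebra.
Import GRing.Theory.
Local Open Scope ring_scope.

(* Let [X] be the singular points of [U^perp] outside [U].  Switching flips exactly the
   adjacencies between [X] and the points off [U^perp].  If [U] is the single point [u],
   swapping [x] and [x + u] on [X] is an isomorphism.

   In the point graph every edge [x, y] has a third vertex [w = x + y] such that each
   vertex is non-adjacent to an even number of [x, y, w].  If [dim U >= 2], take [x] in
   [X] and [y] off [U^perp], non-orthogonal, so that they become adjacent by switching.
   A third vertex [w] cannot lie in [U^perp], since parity at the points of [U] would put
   [y] there too; and if [w] is off [U^perp], parity says that [x + y + w] is
   non-orthogonal to every point off [U^perp].  But there are lines off [U^perp], and the
   sum of the three points of a line is zero. *)

(** * Arithmetic in the field with two elements *)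

Lemma F2_cases (a : 'F_2) : a = 0 \/ a = 1.
Proof. by case: a => [[|[|m]] // i]; [left | right]; apply: val_inj. Qed.

Lemma addF2 (a : 'F_2) : a + a = 0.
Proof. by case: (F2_cases a) => ->; apply: val_inj. Qed.

Lemma oppF2 (a : 'F_2) : - a = a.
Proof. by apply/eqP; rewrite eq_sym -addr_eq0 addF2. Qed.

Lemma addF2_neq0 (a b : 'F_2) : (a + b != 0) = (a != 0) (+) (b != 0).
Proof. by case: (F2_cases a) => ->; case: (F2_cases b) => ->. Qed.

(** * Bilinearity of the polar form and the orthogonality relation *)

Section Polarity.
Set Implicit Arguments. Unset Strict Implicit.
Context {n : nat} (A : 'M['F_2]_(n.+1)).
Implicit Types (x y z u v w : vec n) (U W : {vspace vec n}).
Local Notation Q := (qf A).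
Local Notation B := (polar A).

Lemma addvv x : x + x = 0.
Proof. by apply/rowP => i; rewrite !mxE addF2. Qed.

Lemma addKv x : involutive (+%R^~ x).
Proof. by move=> y; rewrite -addrA addvv addr0. Qed.

Lemma polarE x y : B x y = (x *m (A + A^T) *m y^T) 0 0.
Proof.
have mxD (M N : 'M['F_2]_1) : (M + N) 0 0 = M 0 0 + N 0 0 by rewrite mxE.
have tr (M : 'M['F_2]_1) : M^T 0 0 = M 0 0 by rewrite mxE.
have Axy : (x *m A^T *m y^T) 0 0 = (y *m A *m x^T) 0 0.
  by rewrite -[RHS]tr !trmx_mul trmxK mulmxA.
rewrite /polar /qf [(x + y)^T]linearD /= !(mulmxDr, mulmxDl) !mxD Axy !oppF2.
(* The four remaining entries become arbitrary scalars, and the identity is checked on all their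
   values. *)
move: (fun_of_matrix _ 0 0) (fun_of_matrix _ 0 0) (fun_of_matrix _ 0 0) (fun_of_matrix _ 0 0) => a b c d.
by case: (F2_cases a) => ->; case: (F2_cases b) => ->; case: (F2_cases c) => ->; case: (F2_cases d) => ->; apply: val_inj.
Qed.

Lemma polarDl x y z : B (x + y) z = B x z + B y z.
Proof. by rewrite !polarE !mulmxDl mxE. Qed.

Lemma polarDr x y z : B x (y + z) = B x y + B x z.
Proof. by rewrite !polarE [(y + z)^T]linearD /= mulmxDr mxE. Qed.

Lemma polarC x y : B x y = B y x.
Proof. by rewrite /polar (addrC x) addrAC. Qed.

Lemma qfD x y : Q (x + y) = Q x + Q y + B x y.
Proof. by rewrite /polar -[_ - Q x - Q y]addrA -opprD [RHS]addrC subrK. Qed.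

Lemma polar0 x : B x 0 = 0.
Proof. by rewrite polarE trmx0 mulmx0 mxE. Qed.

Lemma qf0 : Q 0 = 0.
Proof. by rewrite /qf !mul0mx mxE. Qed.

Lemma polarxx x : B x x = 0.
Proof. by rewrite /polar addvv qf0 sub0r oppF2 addF2. Qed.

Lemma qfZ a x : Q (a *: x) = a * Q x.
Proof. by case: (F2_cases a) => ->; rewrite ?scale0r ?qf0 ?mul0r ?scale1r ?mul1r. Qed.

Lemma tsP U : reflect {in U, forall v, Q v = 0} (totally_singular A U).
Proof.
apply: (iffP forallP) => [H v vU | H v]; last by apply/implyP => /H ->.
by apply/eqP/(implyP (H v)).
Qed.

Lemma ts_polar U : totally_singular A U -> {in U &, forall u v, B u v = 0}.
Proof. by move=> /tsP H u v uU vU; rewrite /polar !H ?rpredD // !subr0. Qed.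

(* Locked, so that unification never unfolds the matrix products in [polar]. *)
Definition nonorth x y : bool := locked (B x y != 0).
Local Notation N := nonorth.

Lemma nonorthE x y : N x y = (B x y != 0).
Proof. by rewrite /nonorth -lock. Qed.

Lemma nonorthDl x y z : N (x + y) z = N x z (+) N y z.
Proof. by rewrite !nonorthE polarDl; apply: addF2_neq0. Qed.

Lemma nonorthDr x y z : N x (y + z) = N x y (+) N x z.
Proof. by rewrite !nonorthE polarDr; apply: addF2_neq0. Qed.

Lemma nonorthC x y : N x y = N y x.
Proof. by rewrite !nonorthE polarC. Qed.

Lemma nonorth0 x : N x 0 = false.
Proof. by rewrite nonorthE polar0. Qed.

Lemma nonorthxx x : N x x = false.
Proof. by rewrite nonorthE polarxx. Qed.

Lemma nonorthZ a x y : N x (a *: y) = (a == 1) && N x y.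
Proof.
by case: (F2_cases a) => ->; rewrite ?scale0r ?scale1r ?nonorth0.
Qed.

Lemma nonorth_coord_sum x m (k : 'I_m -> 'F_2) (y : 'I_m -> vec n) :
  (forall i, ~~ N x (y i)) -> ~~ N x (\sum_i k i *: y i).
Proof.
move=> H; elim/big_rec: _ => [|i z _ IH]; first by rewrite nonorth0.
by rewrite nonorthDr nonorthZ (negbTE (H i)) andbF.
Qed.

Lemma nonorthN x y : ~~ N x y -> B x y = 0.
Proof. by rewrite nonorthE negbK => /eqP. Qed.

Lemma qfD_orth x y : ~~ N x y -> Q (x + y) = Q x + Q y.
Proof. by rewrite qfD => /nonorthN ->; rewrite addr0. Qed.

Lemma qfD_nonorth x y : N x y -> Q (x + y) = Q x + Q y + 1.
Proof. by rewrite qfD nonorthE; case: (F2_cases (B x y)) => ->. Qed.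

Lemma ts_nonorth U u v : totally_singular A U -> u \in U -> v \in U -> N u v = false.
Proof. by move=> tsU uU vU; rewrite nonorthE (ts_polar tsU). Qed.

(** * Totally singular sums and the point graph *)

Lemma ts_addvP U W :
  reflect [/\ totally_singular A U, totally_singular A W &
              {in U & W, forall u w, ~~ N u w}]
          (totally_singular A (U + W)%VS).
Proof.
apply: (iffP idP) => [tsUW | [/tsP tsU /tsP tsW UW]].
  have sUl := subvP (addvSl U W); have sUr := subvP (addvSr U W).
  split; first by apply/tsP => v /sUl; apply/tsP.
  - by apply/tsP => v /sUr; apply/tsP.
  - by move=> u w /sUl uU /sUr wU; rewrite (ts_nonorth tsUW).
by apply/tsP => v /memv_addP[u uU [w wW ->]]; rewrite qfD_orth ?UW // tsU ?tsW ?addr0.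
Qed.

Lemma ts_line x : totally_singular A <[x]>%VS = (Q x == 0).
Proof.
apply/tsP/eqP => [-> // | Qx v /vlineP[k ->]]; first exact: memv_line.
by rewrite qfZ Qx mulr0.
Qed.

Lemma ts_addv_line U x : totally_singular A U -> Q x = 0 ->
  totally_singular A (U + <[x]>)%VS = [forall u : vec n, (u \in U) ==> ~~ N u x].
Proof.
move=> tsU Qx; apply/ts_addvP/forallP => [[_ _ H] u | H].
  by apply/implyP => uU; apply: H; rewrite ?memv_line.
rewrite ts_line Qx; split=> // u w uU /vlineP[k ->].
by rewrite nonorthZ (negbTE (implyP (H u) uU)) andbF.
Qed.

Lemma qpointsP x : reflect (x != 0 /\ Q x = 0) (x \in qpoints A).
Proof. by rewrite inE; apply: (iffP andP) => -[? /eqP]. Qed.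

Lemma nonorth_neq0 x y : N x y -> x != 0.
Proof. by apply: contraTneq => ->; rewrite nonorthC nonorth0. Qed.

Lemma gadjE : {in qpoints A &, forall x y, gadj A x y = (x != y) && ~~ N x y}.
Proof.
move=> x y /qpointsP[_ Qx] /qpointsP[_ Qy]; rewrite /gadj; congr andb.
rewrite ts_addv_line ?ts_line ?Qx //; apply/forallP/idP => [/(_ x) | Nxy u].
  by rewrite memv_line.
apply/implyP => /vlineP[k ->].
by rewrite nonorthC nonorthZ nonorthC (negbTE Nxy) andbF.
Qed.

(** Adjacency excludes equality; grouping the two leaves exactly non-orthogonality as complement,
    which is additive in each argument. *)
Lemma nonadjE : {in qpoints A &, forall x y, ~~ (gadj A x y || (x == y)) = N x y}.
Proof.
move=> x y qx qy; rewrite gadjE //; case: (eqVneq x y) => [-> | _] /=.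
  by rewrite nonorthxx.
by rewrite orbF negbK.
Qed.

(* Every edge [x, y] of the point graph lies on the line [x, y, x + y], and any point
   is non-adjacent to an even number of the points of this line. *)
Lemma line_parity : {in qpoints A &, forall x y, gadj A x y ->
  exists2 w, w \in qpoints A & {in qpoints A, forall z,
    ~~ (gadj A w z || (w == z))
      = ~~ (gadj A x z || (x == z)) (+) ~~ (gadj A y z || (y == z))}}.
Proof.
move=> x y qx qy; rewrite gadjE // => /andP[xy Nxy].
have qw : x + y \in qpoints A.
  move/qpointsP: qx => [_ Qx]; move/qpointsP: qy => [_ Qy]; apply/qpointsP.
  rewrite qfD_orth // Qx Qy addr0; split=> //; apply: contraNneq xy => xy0.
  by rewrite -[x](addKv y) xy0 add0r.
by exists (x + y) => // z qz; rewrite !nonadjE // nonorthDl.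
Qed.

(** * The switched graph *)

Section Switching.
Context (U : {vspace vec n}).
Hypothesis tsU : totally_singular A U.

Definition perp x : bool := locked [forall u : vec n, (u \in U) ==> ~~ N u x].

Lemma perpP x : reflect {in U, forall u, ~~ N u x} (perp x).
Proof.
rewrite /perp -lock; apply: (iffP forallP) => [H v vU | H v].
  exact: (implyP (H v)).
by apply/implyP => /H.
Qed.

Lemma perpPn x : reflect (exists2 u, u \in U & N u x) (~~ perp x).
Proof.
rewrite /perp -lock; apply: (iffP forallPn) => -[u].
  by rewrite negb_imply negbK => /andP[uU]; exists u.
by move=> uU Nux; exists u; rewrite uU Nux.
Qed.

Lemma perp_mem x : x \in U -> perp x.
Proof. by move=> xU; apply/perpP => u uU; rewrite (ts_nonorth tsU). Qed.

Lemma perpDr u x : perp u -> perp (x + u) = perp x.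
Proof.
move=> /perpP pu.
apply/perpP/perpP => H v vU; have := H v vU; by rewrite nonorthDr (negbTE (pu v vU)) addbF.
Qed.

Lemma in_Xs x : (x \in Xs A U) = [&& x \in qpoints A, x \notin U & perp x].
Proof.
rewrite inE /type_ii; case: qpointsP => //= -[_ Qx]; congr andb.
by rewrite ts_addv_line // /perp -lock.
Qed.

Lemma Xs_qpoints x : x \in Xs A U -> x \in qpoints A.
Proof. by rewrite in_Xs => /and3P[]. Qed.

Lemma Xs_perp x : x \in Xs A U -> perp x.
Proof. by rewrite in_Xs => /and3P[]. Qed.

(** [U] is totally singular and orthogonal to [x], so translation by [u] changes neither the value
    of the form nor membership in $U^\perp$. *)
Lemma XsD x u : u \in U -> x \in Xs A U -> x + u \in Xs A U.
Proof.
move=> uU; rewrite !in_Xs => /and3P[/qpointsP[x0 Qx] xU px].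
have xuU : x + u \notin U by rewrite rpredDr.
rewrite xuU (perpDr _ (perp_mem uU)) px !andbT; apply/qpointsP; split.
  by apply: contraNneq xuU => ->; rewrite mem0v.
by rewrite qfD_orth ?Qx ?(tsP _ tsU _ uU) ?addr0 // nonorthC (perpP _ px).
Qed.

Lemma in_Ys x : (x \in Ys A U) = (x \in qpoints A) && (x \notin Xs A U).
Proof.
rewrite !inE /type_iii /type_i /type_ii inE; case: (_ && (_ == _)) => //=.
by case: (x \in U).
Qed.

(* A point [x] outside the perp of [U] meets [Xs] in half of its points: translation
   by some [u] in [U] not orthogonal to [x] exchanges neighbours and non-neighbours. *)
Lemma switchingE x y : x \in qpoints A -> y \in Xs A U ->
  switching A U x = ~~ perp x.
Proof.
move=> qx yX; rewrite /switching in_Ys in_Xs qx /=.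
set P := [set p in _ | _].
have [xp /= | npx] := boolP (perp x).
  case: (boolP (x \in U)) => //= xU; apply/negbTE.
  (* A point of [U] is adjacent to all of [Xs], which is nonempty because of [y], so the half count
     fails. *)
  have -> : P = Xs A U.
    apply/setP => p; rewrite inE; case: (boolP (p \in Xs A U)) => //= pX.
    rewrite gadjE ?(Xs_qpoints pX) // (perpP _ (Xs_perp pX)) // andbT.
    by move: pX; rewrite in_Xs => /and3P[_ pU _]; apply: contraNneq pU => <-.
  by rewrite -addnn -[X in _ != X]addn0 eqn_add2l -lt0n; apply/card_gt0P; exists y.
rewrite andbF /=; have /perpPn[u uU Nux] := npx.
have inP p : (p \in P) = (p \in Xs A U) && ~~ N x p.
  rewrite inE; case: (boolP (p \in Xs A U)) => //= pX.
  rewrite gadjE ?(Xs_qpoints pX) //; case: eqP => // xp.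
  by rewrite xp (Xs_perp pX) in npx.
have cP : #|Xs A U :\: P| = #|P|.
  rewrite -(card_preimset P (inv_inj (addKv u))); apply: eq_card => p.
  have -> : (p \in (+%R^~ u) @^-1: P) = (p + u \in P) by rewrite inE.
  rewrite in_setD !inP nonorthDr (nonorthC x u) Nux addbT negbK.
  have -> : (p + u \in Xs A U) = (p \in Xs A U).
    by apply/idP/idP => [/(XsD uU)|]; [rewrite addKv | apply: XsD].
  by case: (_ \in _) => //=; case: (N x p).
rewrite -(cardsID P (Xs A U)) cP (setIidPr _) ?addnn ?eqxx //.
by apply/subsetP => p; rewrite inE => /andP[].
Qed.

(** Ordered pairs that get flipped, with the half count replaced by the geometric condition of
    [switchingE]. *)
Definition crosses x y : bool := ~~ perp x && (y \in Xs A U).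

Lemma crosses_asym x y : crosses x y -> ~~ crosses y x.
Proof. by rewrite /crosses => /andP[_ /Xs_perp ->]. Qed.

Lemma crossesxx x : crosses x x = false.
Proof. by have := @crosses_asym x x; case: (crosses x x) => // /(_ isT). Qed.

Lemma gadj_sE : {in qpoints A &, forall x y,
  gadj_s A U x y = gadj A x y (+) (crosses x y || crosses y x)}.
Proof.
have sw x y : x \in qpoints A -> switching A U x && (y \in Xs A U) = crosses x y.
  move=> qx; rewrite /crosses; case: (boolP (y \in Xs A U)) => [yX | _].
    by rewrite (switchingE qx yX).
  by rewrite !andbF.
move=> x y qx qy; rewrite /gadj_s !sw //.
by case: (crosses x y) => /=; [rewrite addbT | case: (crosses y x); rewrite ?addbT ?addbF].
Qed.

Lemma nonadj_sE : {in qpoints A &, forall x y,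
  ~~ (gadj_s A U x y || (x == y)) = N x y (+) (crosses x y || crosses y x)}.
Proof.
move=> x y qx qy; rewrite gadj_sE // -nonadjE //.
case: (eqVneq x y) => [-> | _]; last by rewrite !orbF addNb.
by rewrite !orbT crossesxx.
Qed.

End Switching.

(* Fix the unique nonzero vector [u] of [U] and swap [x] with [x + u] on [Xs]. *)
Lemma switch_point_iso U : totally_singular A U -> \dim U = 1%N ->
  graph_iso (qpoints A) (gadj A) (gadj_s A U).
Proof.
move=> tsU dU.
have [u Uu] : exists u, forall v, (v \in U) = (v == 0) || (v == u).
  have u0 : vpick U != 0 by rewrite vpick0 -dimv_eq0 dU.
  have eU : <[vpick U]>%VS = U.
    by apply/eqP; rewrite eqEdim dU dim_vline u0 -memvE memv_pick.
  exists (vpick U) => v; rewrite -{1}eU; apply/vlineP/orP => [[k ->] | []/eqP->].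
  - by case: (F2_cases k) => ->; rewrite ?scale0r ?scale1r eqxx; [left | right].
  - by exists 0; rewrite scale0r.
  - by exists 1; rewrite scale1r.
have uU : u \in U by rewrite Uu eqxx orbT.
pose f x := if x \in Xs A U then x + u else x.
have fX x : (f x \in Xs A U) = (x \in Xs A U).
  rewrite /f; case: (boolP (x \in Xs A U)) => [xX | /negbTE -> //].
  by rewrite XsD.
have fK : involutive f.
  by move=> x; rewrite {1}/f fX /f; case: (x \in Xs A U); rewrite ?addKv.
have fq x : x \in qpoints A -> f x \in qpoints A.
  by rewrite /f; case: ifP => // xX _; apply: (Xs_qpoints tsU); apply: XsD.
have pf x : perp U (f x) = perp U x.
  by rewrite /f; case: ifP => [_ | _ //]; apply: perpDr; apply: perp_mem.
have Nu x : N x u = ~~ perp U x.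
  apply/idP/perpPn => [Nxu | [v]]; first by exists u; rewrite // nonorthC.
  by rewrite Uu nonorthC => /orP[] /eqP -> //; rewrite nonorth0.
(* Translation adds a bilinear correction; by [Nu] it is nonzero exactly on crossing pairs, and it
   vanishes between two points of [Xs]. *)
have Nf x y : N (f x) (f y) = N x y (+)
    ((x \in Xs A U) && N y u (+) (y \in Xs A U) && N x u).
  rewrite /f; case: (x \in Xs A U); case: (y \in Xs A U); rewrite /= ?addbF //.
  - rewrite nonorthDl !nonorthDr nonorthxx (nonorthC u y).
    by case: (N x y); case: (N x u); case: (N y u).
  - by rewrite nonorthDl (nonorthC u y).
  - by rewrite nonorthDr.
exists f; split.
- by move=> x y _ _ /(inv_inj fK).
- apply/setP => x; apply/imsetP/idP => [[y qy ->] | qx]; first exact: fq.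
  by exists (f x); rewrite ?fq ?fK.
move=> x y qx qy.
have H : ~~ (gadj_s A U (f x) (f y) || (f x == f y)) = ~~ (gadj A x y || (x == y)).
  rewrite (nonadj_sE tsU (fq _ qx) (fq _ qy)) (nonadjE qx qy).
  rewrite Nf !Nu /crosses !fX !pf.
  move: (@Xs_perp _ tsU x) (@Xs_perp _ tsU y).
  case: (x \in _); case: (y \in _); case: (perp U x); case: (perp U y);
    by do [by move/(_ isT) | by move=> _ /(_ isT) | case: (N x y)].
move: H; rewrite (inj_eq (inv_inj fK)); case: eqVneq => [-> _ | _].
  by rewrite (gadj_sE tsU) ?fq // (crossesxx tsU) !gadjE ?fq // !eqxx.
by rewrite !orbF => /negb_inj.
Qed.

(** * Obstruction for subspaces of vector dimension at least two *)

Section NotIsomorphic.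
Context (U : {vspace vec n}).
Hypothesis nsA : nonsingular A.
Hypothesis tsU : totally_singular A U.

(** Non-singularity keeps a nonzero singular vector out of the radical of the polar form. *)
Lemma nonorth_ex u : u \in U -> u != 0 -> exists z, N z u.
Proof.
move=> uU u0; case: (pickP (fun z => N z u)) => [z | H]; first by exists z.
case: (nsA u0 (tsP _ tsU _ uU)) => z.
by apply: nonorthN; rewrite nonorthC H.
Qed.

(** Let [C] complement the intersection of [U] and [W] in [U]. Orthogonality to [C] imposes at most
    [\dim C] conditions on the larger space [W], so some solution lies outside [U]; it is orthogonal
    to the intersection because [W] is totally singular. *)
Lemma Xs_neq0 g : proj_index A g -> (\dim U < g.+1)%N -> exists x, x \in Xs A U.
Proof.
move=> [[W [tsW dW]] _] ltUg.
pose C := (U :\: W)%VS.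
pose M : 'M['F_2]_(\dim C, n.+1) := \matrix_(i, j) (vbasis C)`_i 0 j.
pose f : 'Hom(vec n, 'rV['F_2]_(\dim C)) := linfun (mulmxr ((A + A^T) *m M^T)).
have fE x i : f x 0 i = B x (vbasis C)`_i.
  rewrite lfunE /= polarE mulmxA !mxE; apply: eq_bigr => j _.
  by rewrite !mxE.
have dker : (\dim (U :&: W) < \dim (W :&: lker f))%N.
  have dimg : (\dim (f @: W) <= \dim C)%N.
    by rewrite (leq_trans (dimvS (subvf _))) // dimvf /dim /= mul1n.
  rewrite -(ltn_add2r (\dim C)) dimv_cap_compl (leq_trans ltUg) // -dW.
  by rewrite -(limg_ker_dim f W) leq_add2l.
have /subvPn[x] : ~~ (W :&: lker f <= U :&: W)%VS.
  by apply: contraL dker => /dimvS; rewrite -leqNgt.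
rewrite !memv_cap memv_ker => /andP[xW /eqP fx]; rewrite xW andbT => xU.
exists x; rewrite in_Xs // xU; apply/andP; split.
  apply/qpointsP; split; last exact: (tsP _ tsW).
  by apply: contraNneq xU => ->; rewrite mem0v.
apply/perpP => u; rewrite -(addv_diff_cap U W) => /memv_addP[c cC [d]].
rewrite memv_cap => /andP[_ dW'] ->; rewrite nonorthDl (ts_nonorth tsW dW' xW) addbF.
rewrite nonorthC (coord_vbasis cC); apply: nonorth_coord_sum => i.
by rewrite nonorthE -fE fx mxE eqxx.
Qed.

(** Adding [u] flips the value of the form at [z], but no pairing with [U]. *)
Lemma singular_lift z u : u \in U -> N z u ->
  exists2 z', Q z' = 0 & {in U, N z' =1 N z}.
Proof.
move=> uU Nzu; have Qu := tsP _ tsU _ uU.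
case: (F2_cases (Q z)) => Qz; first by exists z.
exists (z + u); first by rewrite qfD_nonorth // Qz Qu addr0 addF2.
by move=> w wU; rewrite nonorthDl (ts_nonorth tsU uU wU) addbF.
Qed.

(** With [a] non-orthogonal to [u], and [b] to [u + v], one of [a], [b], [a + b] serves. *)
Lemma nonorth_sep u v : u \in U -> v \in U -> u != 0 -> u != v ->
  exists z, N z u && ~~ N z v.
Proof.
move=> uU vU u0 uv; have [a Nau] := nonorth_ex uU u0.
have uv0 : u + v != 0 by apply: contraNneq uv => uv0; rewrite -[u](addKv v) uv0 add0r.
have [b] := nonorth_ex (rpredD uU vU) uv0; rewrite nonorthDr => Nb.
case: (boolP (N a v)) => Nav; last by exists a; rewrite Nau.
case: (boolP (N b v)) Nb => Nbv Nbu; last by exists b; rewrite -[N b u]addbF Nbu.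
exists (a + b); rewrite !nonorthDl Nau Nav Nbv.
by move: Nbu; case: (N b u).
Qed.

(** Two independent vectors [u], [v] of [U] detect the points: [z1] and [z1 + z2] are non-orthogonal
    to [u], and [z2] to [v]. *)
Lemma line_off_perp : (1 < \dim U)%N ->
  exists z1 z2, [/\ z1 \in qpoints A, z2 \in qpoints A, z1 + z2 \in qpoints A &
                 [/\ ~~ perp U z1, ~~ perp U z2 & ~~ perp U (z1 + z2)]].
Proof.
move=> dU; have uU := memv_pick U; set u := vpick U in uU.
have u0 : u != 0 by rewrite vpick0 -dimv_eq0 -lt0n ltnW.
have /subvPn[v vU vu] : ~~ (U <= <[u]>)%VS.
  by apply: contraL dU => /dimvS; rewrite -leqNgt dim_vline u0.
have uv : u != v by apply: contraNneq vu => <-; apply: memv_line.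
have v0 : v != 0 by apply: contraNneq vu => ->; apply: mem0v.
have [b1 /andP[Nb1u Nb1v]] := nonorth_sep uU vU u0 uv.
have [b2 /andP[Nb2v Nb2u]] := nonorth_sep vU uU v0 (contra_neq esym uv).
have [z1 Qz1 Nz1] := singular_lift uU Nb1u.
have [z2 [Qz2 Nz2 Nz12]] :
    exists z2, [/\ Q z2 = 0, {in U, N z2 =1 N b2} & ~~ N z1 z2].
  have [z2 Qz2 Nz2] := singular_lift vU Nb2v.
  case: (boolP (N z1 z2)) => Nz12; last by exists z2.
  (* As [z2] is orthogonal to [u] and [z1] is not, adding [u] keeps [z2] singular and makes it
     orthogonal to [z1]. *)
  exists (z2 + u); split.
  - by rewrite qfD_orth ?Nz2 // Qz2 (tsP _ tsU _ uU) addr0.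
  - by move=> w wU; rewrite nonorthDl (ts_nonorth tsU uU wU) addbF Nz2.
  - by rewrite nonorthDr Nz12 Nz1 // Nb1u.
have off z w : Q z = 0 -> w \in U -> N z w -> z \in qpoints A /\ ~~ perp U z.
  move=> Qz wU Nzw; split; last by apply/perpPn; exists w; rewrite // nonorthC.
  by apply/qpointsP; split=> //; apply: nonorth_neq0 Nzw.
have [q1 n1] : z1 \in qpoints A /\ ~~ perp U z1 by apply: (off _ u); rewrite ?Nz1.
have [q2 n2] : z2 \in qpoints A /\ ~~ perp U z2 by apply: (off _ v); rewrite ?Nz2.
have [q3 n3] : z1 + z2 \in qpoints A /\ ~~ perp U (z1 + z2).
  apply: (off _ u) => //; first by rewrite qfD_orth // Qz1 Qz2 addr0.
  by rewrite nonorthDl Nz1 // Nz2 // Nb1u (negbTE Nb2u).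
by exists z1, z2.
Qed.

Lemma switch_subspace_not_iso : (1 < \dim U)%N -> (exists x, x \in Xs A U) ->
  ~ graph_iso (qpoints A) (gadj A) (gadj_s A U).
Proof.
move=> dU [x0 x0X] [f [finj fV fE]].
have [z1 [z2 [q1 q2 q3 [n1 n2 n3]]]] := line_off_perp dU.
have [u uU Nuz1] := perpPn _ _ n1.
have [x xX Nx] : exists2 x, x \in Xs A U & N x z1.
  case: (boolP (N x0 z1)) => Nx; first by exists x0.
  by exists (x0 + u); rewrite ?XsD // nonorthDl (negbTE Nx).
have qx := Xs_qpoints tsU xX; have px := Xs_perp tsU xX.
have fP y : y \in qpoints A -> exists2 a, a \in qpoints A & f a = y.
  by rewrite -{1}fV => /imsetP[a qa ->]; exists a.
have [a qa fa] := fP x qx; have [b qb fb] := fP z1 q1.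
have ab : gadj A a b.
  rewrite -fE // fa fb (gadj_sE tsU) // gadjE //.
  by rewrite Nx andbF /crosses xX n1 orbT.
have [c qc par0] := line_parity qa qb ab.
pose w := f c; have qw : w \in qpoints A by rewrite -fV imset_f.
(* Line parity in the point graph, carried over by [f] to the switched graph. *)
have par z : z \in qpoints A ->
    N w z (+) (crosses U w z || crosses U z w)
    = N x z (+) (crosses U x z || crosses U z x)
      (+) (N z1 z (+) (crosses U z1 z || crosses U z z1)).
  move=> qz; have [d qd fd] := fP z qz.
  rewrite -!(nonadj_sE tsU) // -fd -fa -fb /w !fE // !(inj_in_eq finj) //.
  exact: par0.
have nX z : ~~ perp U z -> z \in Xs A U = false.
  by move=> nz; apply: contraNF nz; apply: Xs_perp.
(* No pair containing [u] crosses, so parity at [u] would make [z1] orthogonal to [u]. *)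
have [pw | nw] := boolP (perp U w).
  have qu : u \in qpoints A.
    by apply/qpointsP; split; [apply: nonorth_neq0 Nuz1 | apply: (tsP _ tsU)].
  have cu z : crosses U z u || crosses U u z = false.
    by rewrite /crosses (perp_mem tsU uU) (in_Xs tsU u) uU !andbF.
  have := par u qu; rewrite (cu w) (cu x) (cu z1) !addbF !(nonorthC _ u) Nuz1.
  by rewrite (negbTE (perpP _ _ px _ uU)) (negbTE (perpP _ _ pw _ uU)).
(* Among [w], [x], [z1] only [x] lies in [Xs], so exactly one flip occurs against [z]. *)
have odd z : z \in qpoints A -> ~~ perp U z -> N w z (+) N x z (+) N z1 z.
  move=> qz nz; have Xz := nX z nz.
  have cz y : crosses U y z || crosses U z y = (y \in Xs A U).
    by rewrite /crosses Xz nz andbF.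
  have := par z qz; rewrite (cz w) (cz x) (cz z1) xX (nX w nw) (nX z1 n1).
  by case: (N w z); case: (N x z); case: (N z1 z).
(* Three odd parities sum to one, while bilinearity on the line makes them sum to zero. *)
have := odd _ q1 n1; have := odd _ q2 n2; have := odd _ q3 n3.
rewrite !nonorthDr.
by case: (N w z1); case: (N w z2); case: (N x z1); case: (N x z2);
  case: (N z1 z1); case: (N z1 z2).
Qed.

End NotIsomorphic.
End Polarity.

Theorem theorem6p1 (n : nat) (A : 'M['F_2]_(n.+1)) (g s : nat)
    (U : {vspace 'rV['F_2]_(n.+1)}) :
  nonsingular A -> proj_index A g -> (1 <= g)%N -> (s < g)%N ->
  totally_singular A U -> \dim U = s.+1 ->
  (graph_iso (qpoints A) (gadj A) (gadj_s A U) <-> s = 0%N).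
Proof.
move=> nsA ig _ ltsg tsU dU; split=> [iso | s0]; last first.
  by apply: switch_point_iso; rewrite ?dU ?s0.
case: s dU ltsg => // s dU ltsg.
by case: (@switch_subspace_not_iso _ _ _ nsA tsU) => //; [rewrite dU | apply: (Xs_neq0 tsU ig); rewrite dU].
Qed.
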